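(* Let $G$ be a finite abelian group of cardinality $n\ge 2$, with a symmetric duality bracket $\langle\cdot,\cdot\rangle:G\times G\to\mathbb{T}$, and let $\lambda$ be the unital $*$-endomorphism of $\mathcal{O}_n$ (with generators $S_g$, $g\in G$) given by \[ \lambda(S_g)=\frac{1}{\sqrt n}\sum_{h\in G}\langle g,h\rangle S_hU(g)^*,\qquad U(g)=\sum_{h\in G}\langle g,h\rangle S_hS_h^*,\qquad g\in G. \] Let $\beta$ be the Bogolyubov automorphism of $\mathcal{O}_n$ given by $\beta(S_h)=\frac{1}{\sqrt n}\sum_{a\in G}\langle h,a\rangle S_a$, $h\in G$. Then: (1) $\lambda\circ\beta$ is a permutation endomorphism; explicitly, $(\lambda\circ\beta)(S_h)=\sum_{b\in G}S_bS_{h+b}S_{h+b}^*$ for all $h\in G$. In particular $\lambda$ is the composition of a permutation endomorphism with a Bogolyubov automorphism. (2) $\lambda^2$ is a permutation endomorphism; explicitly, $\lambda^2(S_g)=\sum_{k\in G}S_kS_{g+k}S_k^*$ for all $g\in G$, and the unitary associated with $\lambda^2$ is $\sum_{g,h\in G}S_gS_{h+g}S_g^*S_h^*$.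
   Context: $\mathcal{O}_n$ is the Cuntz algebra with its $n$ generating isometries indexed by $G$: $\{S_g: g\in G\}$ with $\sum_{g\in G}S_gS_g^*=I$. The group $G$ is written additively with identity $e$, and the symmetric duality bracket satisfies, for all $g,g',h\in G$: $\overline{\langle g,h\rangle}=\langle -g,h\rangle$; $\sum_{h\in G}\langle h,g\rangle=0$ if $g\ne e$ and $=n$ if $g=e$; $\langle g,h\rangle\langle g',h\rangle=\langle g+g',h\rangle$; $\langle g,h\rangle=\langle h,g\rangle$. For a unitary $u\in\mathcal{O}_n$, $\lambda_u$ is the unital $*$-endomorphism determined by $\lambda_u(S_g)=uS_g$ for $g\in G$; every unital $*$-endomorphism $\rho$ is $\lambda_u$ for the associated unitary $u=\sum_{g\in G}\rho(S_g)S_g^*$. A Bogolyubov automorphism is $\lambda_z$ with $z$ a unitary in $\operatorname{span}\{S_gS_h^*: g,h\in G\}$. A permutation endomorphism is $\lambda_u$ with $u=\sum_{\alpha\in G^k}S_{\sigma(\alpha)}S_\alpha^*$ for some positive integer $k$ and some permutation $\sigma$ of $G^k$, where $S_\alpha=S_{\alpha_1}\cdots S_{\alpha_k}$. *)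

(* Defs.v *)
From HB Require Import structures.
From mathcomp Require Import all_boot all_order all_algebra all_fingroup.
From mathcomp Require Import reals.
From mathcomp Require Import complex.
Set Implicit Arguments.
Unset Strict Implicit.
Unset Printing Implicit Defensive.
Import Order.TTheory GRing.Theory Num.Theory.
Local Open Scope ring_scope.
Local Open Scope complex_scope.

(* Unital C*-algebras over the complex numbers R[i].  The norm is a field of
   its own because normed modules cannot be combined with the ring structures
   of the library: their only join is numDomainType.  Nonnegativity of the
   norm follows from the axioms. *)
HB.mixin Record isCStar (R : realType) A & GRing.Algebra R[i] A := {
  star : A -> A ;
  starK : involutive star ;
  starD : {morph star : x y / x + y} ;
  starZ : forall (c : R[i]) (x : A), star (c *: x) = Num.conj c *: star x ;
  starM : forall x y : A, star (x * y) = star y * star x ;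
  cnorm : A -> R ;
  cnorm_eq0 : forall x : A, cnorm x = 0 -> x = 0 ;
  cnormD : forall x y : A, cnorm (x + y) <= cnorm x + cnorm y ;
  cnormZ : forall (c : R[i]) (x : A), cnorm (c *: x) = complex.Re `|c| * cnorm x ;
  cnormM : forall x y : A, cnorm (x * y) <= cnorm x * cnorm y ;
  cnorm_star : forall x : A, cnorm (star x * x) = cnorm x ^+ 2 ;
  cnorm_complete : forall u : nat -> A,
    (forall e : R, 0 < e -> exists N : nat, forall m n : nat,
       (N <= m)%N -> (N <= n)%N -> cnorm (u m - u n) < e) ->
    exists l : A, forall e : R, 0 < e -> exists N : nat, forall n : nat,
      (N <= n)%N -> cnorm (u n - l) < e
}.

#[short(type="cstarType")]
HB.structure Definition CStar (R : realType) :=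
  {A of isCStar R A & GRing.Algebra R[i] A}.

Section CStarAlgebras.
Variable R : realType.

(* No continuity is required: it is automatic for *-homomorphisms. *)
Record star_morphism (A B : cstarType R) (f : A -> B) : Prop := StarMorphism {
  star_morphism_linear : linear f ;
  star_morphism_mul : monoid_morphism f ;
  star_morphism_star : {morph f : x / star x}
}.

Definition is_unitary (A : cstarType R) (u : A) : Prop :=
  star u * u = 1 /\ u * star u = 1.

End CStarAlgebras.

Section Cuntz.
Variables (R : realType) (G : finZmodType).

Definition cuntz_relations (A : cstarType R) (S : G -> A) : Prop :=
  (forall g, star (S g) * S g = 1) /\ \sum_g S g * star (S g) = 1.

(* The Cuntz algebra, as the universal C*-algebra for the Cuntz relations;
   this determines (On, S) up to unique isomorphism. *)
Definition is_cuntz_algebra (On : cstarType R) (S : G -> On) : Prop :=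
  cuntz_relations S /\
  forall (B : cstarType R) (T : G -> B), cuntz_relations T ->
    exists! f : On -> B, star_morphism f /\ forall g, f (S g) = T g.

Variables (On : cstarType R) (S : G -> On).

(* rho = lambda_u; since S generates On, u determines rho. *)
Definition is_lambda (u : On) (rho : On -> On) : Prop :=
  [/\ is_unitary u, star_morphism rho & forall g, rho (S g) = u * S g].

Definition associated_unitary (rho : On -> On) : On :=
  \sum_g rho (S g) * star (S g).

Definition cuntz_word (k : nat) (alpha : k.-tuple G) : On :=
  \prod_(g <- alpha) S g.

Definition permutation_endomorphism (rho : On -> On) : Prop :=
  exists (k : nat) (sigma : {perm k.-tuple G}), (0 < k)%N /\
    is_lambda
      (\sum_alpha cuntz_word (sigma alpha) * star (cuntz_word alpha)) rho.

(* Bijectivity is automatic: lambda_(star z) is the inverse of lambda_z for a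
   unitary z in the span of the S g * star (S h). *)
Definition bogolyubov_automorphism (rho : On -> On) : Prop :=
  bijective rho /\
  exists c : G -> G -> R[i],
    is_lambda (\sum_g \sum_h c g h *: (S g * star (S h))) rho.

(* Multiplicativity in the second argument follows by symmetry, and
   nondegeneracy from bracket_sum. *)
Record symmetric_duality_bracket (br : G -> G -> R[i]) : Prop := DualityBracket {
  bracket_norm : forall g h, `|br g h| = 1 ;
  bracket_conj : forall g h, Num.conj (br g h) = br (- g) h ;
  bracket_sum : forall g, \sum_h br h g = if g == 0 then #|G|%:R else 0 ;
  bracket_mul : forall g g' h, br g h * br g' h = br (g + g') h ;
  bracket_sym : forall g h, br g h = br h g
}.

End Cuntz.

(* Main.v *)
Require Import Defs.
From HB Require Import structures.
From mathcomp Require Import all_boot all_order all_algebra all_fingroup.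
From mathcomp Require Import reals.
From mathcomp Require Import complex ring lra.
Set Implicit Arguments.
Unset Strict Implicit.
Unset Printing Implicit Defensive.
Import Order.TTheory GRing.Theory Num.Theory.
Local Open Scope ring_scope.
Local Open Scope complex_scope.

(* The isometries have orthogonal ranges: [star (S h) * 1 * S h] is a sum of the
   positive elements [star x * x], [x = star (S g) * S h], and the term [g = h]
   is already [1].  That a vanishing sum of such elements has vanishing terms is
   obtained from the norm alone, because [1] is an extreme point of the unit
   ball.  With [V h = beta (S h)], the relations make [V] and [V g U(g)^*] Cuntz
   families, so beta and lambda exist by universality, and Fourier inversion on
   [G] gives

     lambda (V h) = sum_b S_b S_(h+b) S_(h+b)^*,
     lambda (U(g)) = sum_a S_a S_(a+g)^*,

   whence lambda^2, since lambda (S_g) = V g U(g)^*.  Moreover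
   beta^2 (S_h) = S_(-h), so beta has the Bogolyubov inverse beta^3.  The
   permutations of [G * G] involved are (x, y) |-> (y - x, y) for lambda o beta
   and (x, y) |-> (y, x + y) for lambda^2. *)

(** * Polynomial identities behind the norm estimates *)

Section Identities.
Variables (P : comNzRingType) (t : P).

(** These identities are stated in a commutative ring so that [ring] applies. Taken at the
    polynomial ['X], they pass to an element of a noncommutative algebra through [horner_alg]. *)
Lemma square_even_part : (1 + t ^+ 2) *+ 2 = (1 + t) ^+ 2 + (1 - t) ^+ 2.
Proof. ring. Qed.

Lemma cube_even_part : (1 + t ^+ 2 *+ 3) *+ 2 = (1 + t) ^+ 3 + (1 - t) ^+ 3.
Proof. ring. Qed.

(* For [x] self-adjoint with [1 + x] and [1 - x] contractions, the other
   factors on the right are contractions too, so [5 + 6 x] has norm at most 5. *)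
Lemma extreme_identity : (5 + t *+ 6) ^+ 2 =
  (1 + t) ^+ 3 *+ 18 + ((1 + t) * (1 - t ^+ 2 *+ 3)) *+ 6 + 1.
Proof. ring. Qed.

End Identities.

(** * Norm estimates in a C*-algebra *)

Section CStarFacts.
Variables (R : realType) (A : cstarType R).
Implicit Types x y : A.

Lemma star0 : star (0 : A) = 0.
Proof. by rewrite -[X in star X](scale0r (0 : A)) starZ rmorph0 scale0r. Qed.

Lemma star1 : star (1 : A) = 1.
Proof. by rewrite -[LHS]mulr1 -{2}(starK 1) -starM mulr1 starK. Qed.

Lemma starN x : star (- x) = - star x.
Proof. by rewrite -scaleN1r starZ rmorphN1 scaleN1r. Qed.

Lemma star_sum (I : Type) (r : seq I) (P : pred I) (F : I -> A) :
  star (\sum_(i <- r | P i) F i) = \sum_(i <- r | P i) star (F i).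
Proof. exact: (big_morph _ (@starD R A) star0). Qed.

Lemma cnorm0 : cnorm (0 : A) = 0.
Proof. by rewrite -(scale0r (0 : A)) cnormZ normr0 mul0r. Qed.

Lemma cnormN x : cnorm (- x) = cnorm x.
Proof. by rewrite -scaleN1r cnormZ normrN1 mul1r. Qed.

Lemma cnorm_ge0 x : 0 <= cnorm x.
Proof.
have := cnormD x (- x); rewrite subrr cnorm0 cnormN => h; lra.
Qed.

Lemma cnormZr (r : R) x : 0 <= r -> cnorm (r%:C *: x) = r * cnorm x.
Proof.
by move=> r0; rewrite cnormZ normc_def /= expr0n addr0 sqrtr_sqr ger0_norm.
Qed.

Lemma cnorm_sqr_sa x : star x = x -> cnorm (x * x) = cnorm x ^+ 2.
Proof. by move=> xs; rewrite -cnorm_star xs. Qed.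

(** The C*-identity at [1] reads [r = r ^+ 2] for [r = cnorm 1]. *)
Lemma cnorm1_le1 : cnorm (1 : A) <= 1.
Proof.
have := cnorm_sqr_sa star1; rewrite mulr1.
have := cnorm_ge0 1; move: (cnorm 1) => r r0 e.
have [//|r1] := lerP r 1; nra.
Qed.

Lemma cnormM_le1 x y : cnorm x <= 1 -> cnorm y <= 1 -> cnorm (x * y) <= 1.
Proof.
move=> hx hy; apply: le_trans (cnormM x y) _.
by rewrite mulr_ile1 ?cnorm_ge0.
Qed.

Lemma cnormX_le1 x n : cnorm x <= 1 -> cnorm (x ^+ n) <= 1.
Proof.
move=> hx; elim: n => [|n IH]; first exact: cnorm1_le1.
by rewrite exprS cnormM_le1.
Qed.

Lemma cnorm_mulrn x n : cnorm (x *+ n) = n%:R * cnorm x.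
Proof.
by rewrite -scaler_nat -(rmorph_nat (@real_complex R)) cnormZr.
Qed.

Lemma cnorm_sum (I : Type) (r : seq I) (P : pred I) (F : I -> A) :
  cnorm (\sum_(i <- r | P i) F i) <= \sum_(i <- r | P i) cnorm (F i).
Proof.
elim/big_ind2: _ => //; first by rewrite cnorm0.
by move=> x a y b xa yb; apply: le_trans (cnormD _ _) (lerD xa yb).
Qed.

Lemma cnorm_star_le1 x : cnorm (star x * x) <= 1 -> cnorm x <= 1.
Proof.
rewrite cnorm_star => h; have := cnorm_ge0 x => h0.
have [//|r1] := lerP (cnorm x) 1; nra.
Qed.

Lemma cnorm_isometry_le1 x : star x * x = 1 -> cnorm x <= 1.
Proof. by move=> h; apply: cnorm_star_le1; rewrite h cnorm1_le1. Qed.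

Lemma cnorm_projection_le1 x : star x = x -> x * x = x -> cnorm x <= 1.
Proof.
move=> xs xx; have := cnorm_sqr_sa xs; rewrite xx.
have := cnorm_ge0 x; move: (cnorm x) => r r0 e; clear xs xx.
have [//|r1] := lerP r 1; nra.
Qed.

(** Since 18 + 6 + 1 = 25, [extreme_identity] bounds the norm of the square of [5 + 6 x] by 25. The
    gain is that 6 / 5 exceeds 1, so the step can be iterated. *)
Lemma cnorm_extreme_step x : star x = x ->
  cnorm (1 + x) <= 1 -> cnorm (1 - x) <= 1 -> cnorm (1 + (6 / 5)%:C *: x) <= 1.
Proof.
move=> xs hp hm.
have half (a b : A) : cnorm a <= 1 -> cnorm b <= 1 -> cnorm (a + b) <= 2.
  by move=> ha hb; apply: le_trans (cnormD _ _) _; lra.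
have hsq : cnorm (1 + x ^+ 2) <= 1.
  have e : (1 + x ^+ 2) *+ 2 = (1 + x) ^+ 2 + (1 - x) ^+ 2.
    have := congr1 (horner_alg x) (square_even_part 'X).
    by rewrite !(rmorphMn, rmorphD, rmorphXn, rmorphN, rmorph1) /= !horner_algX.
  have := half _ _ (cnormX_le1 2 hp) (cnormX_le1 2 hm).
  by rewrite -e cnorm_mulrn => h; lra.
(* [|1 + s x|^2 = |1 + x^2|] for [s = i] and [s = -i]. *)
have hI (s : R[i]) : s ^+ 2 = -1 -> Num.conj s = - s -> cnorm (1 + s *: x) <= 1.
  move=> s2 sc; apply: cnorm_star_le1.
  rewrite starD star1 starZ sc xs scaleNr mulrDl !mulrDr !mul1r mulr1 mulNr.
  by rewrite -scalerAl -scalerAr scalerA -expr2 s2 scaleN1r opprK addrA addrK.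
(* The cubic identity is taken at ['i *: x], whose square is [- x ^+ 2]. *)
have hc : cnorm (1 - x ^+ 2 *+ 3) <= 1.
  have e : (1 - x ^+ 2 *+ 3) *+ 2 = (1 + 'i *: x) ^+ 3 + (1 + (- 'i) *: x) ^+ 3.
    have := congr1 (horner_alg ('i *: x)) (cube_even_part 'X).
    rewrite !(rmorphMn, rmorphD, rmorphXn, rmorphN, rmorph1) /= !horner_algX.
    by rewrite exprZn sqr_i scaleN1r mulNrn scaleNr.
  have i1 := hI 'i (@sqr_i R) (conjCi _).
  have i2 : cnorm (1 + (- 'i) *: x) <= 1 by apply: hI; rewrite ?sqrrN ?sqr_i ?rmorphN /= ?conjCi.
  have := half _ _ (cnormX_le1 3 i1) (cnormX_le1 3 i2).
  by rewrite -e cnorm_mulrn => h; lra.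
have e : (1 + (6 / 5)%:C *: x) ^+ 2 *+ 25 =
         (1 + x) ^+ 3 *+ 18 + ((1 + x) * (1 - x ^+ 2 *+ 3)) *+ 6 + 1.
  set y := (6 / 5)%:C *: x.
  have := congr1 (horner_alg x) (extreme_identity 'X).
  rewrite !(rmorphM, rmorphMn, rmorphD, rmorphXn, rmorphN, rmorph1) /= !horner_algX => <-.
  have -> : 5%:R + x *+ 6 = (1 + (6 / 5)%:C *: x) *+ 5.
    rewrite mulrnDl -[(_ *: x) *+ 5]scaler_nat scalerA -[x *+ 6]scaler_nat; congr (_ + _ *: _).
    rewrite -!(rmorph_nat (@real_complex R)) -rmorphM /=; congr (_%:C); by field.
  by rewrite -expr2 exprMn_n.
have sa : star (1 + (6 / 5)%:C *: x) = 1 + (6 / 5)%:C *: x.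
  by rewrite starD star1 starZ xs; congr (_ + _ *: _); apply/conj_Creal; rewrite complex_real.
apply: cnorm_star_le1; rewrite sa -expr2.
have b1 : cnorm ((1 + (6 / 5)%:C *: x) ^+ 2 *+ 25) <= 25.
  rewrite e; apply: le_trans (cnormD _ _) _.
  have := cnormD ((1 + x) ^+ 3 *+ 18) (((1 + x) * (1 - x ^+ 2 *+ 3)) *+ 6).
  rewrite (cnorm_mulrn _ 18) (cnorm_mulrn _ 6).
  have := cnormX_le1 3 hp; have := cnormM_le1 hp hc; have := cnorm1_le1; lra.
rewrite cnorm_mulrn in b1; lra.
Qed.

(* The unit is an extreme point of the unit ball: iterating the previous lemma
   makes [1 + (6 / 5) ^ k x] a contraction for every [k]. *)
Lemma cnorm_extreme x : star x = x ->
  cnorm (1 + x) <= 1 -> cnorm (1 - x) <= 1 -> x = 0.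
Proof.
move=> xs hp hm.
have saZ (r : R) : star (r%:C *: x) = r%:C *: x.
  by rewrite starZ xs; congr (_ *: _); apply/conj_Creal; rewrite complex_real.
have H k : cnorm (1 + ((6 / 5) ^+ k)%:C *: x) <= 1 /\ cnorm (1 - ((6 / 5) ^+ k)%:C *: x) <= 1.
  elim: k => [|k [IH1 IH2]]; first by rewrite expr0 scale1r.
  rewrite exprS rmorphM /= -scalerA; split; first exact: cnorm_extreme_step.
  rewrite -scalerN; apply: cnorm_extreme_step; rewrite ?opprK ?starN ?saZ //.
(* With [y] the scaled element, [2 y] is the difference of the contractions [1 + y] and [1 - y]. *)
have B k : (6 / 5) ^+ k * cnorm x <= 1.
  have [h1 h2] := H k; rewrite -cnormZr ?exprn_ge0 //; last lra.
  have := cnormD (1 + ((6 / 5) ^+ k)%:C *: x) (- (1 - ((6 / 5) ^+ k)%:C *: x)).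
  by rewrite cnormN opprD opprK addrACA subrr add0r -mulr2n cnorm_mulrn => ?; lra.
(* Bernoulli's inequality; the linear growth contradicts [B] unless [cnorm x] vanishes. *)
have bern k : 1 + k%:R / 5 <= (6 / 5) ^+ k :> R.
  elim: k => [|k IH]; first by rewrite mul0r addr0.
  rewrite exprS -natr1; have := ler0n R k; nra.
apply: cnorm_eq0; apply/eqP; rewrite eq_le cnorm_ge0 andbT leNgt; apply/negP => x0.
have [k hk] : exists k : nat, 5 / cnorm x < k%:R.
  by exists (Num.bound (5 / cnorm x)); apply: archi_boundP; rewrite divr_ge0 ?cnorm_ge0.
move: hk; rewrite ltr_pdivrMr // => hk.
have := B k; have := bern k; have := ler0n R k; nra.
Qed.

(** The bound on [1 - F i] stands in for positivity. With [m] terms and [x = F i / m], [1 - x] is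
    the average of [m - 1] units and [1 - F i]. As [F i] is minus the sum of the other terms,
    [1 + x] is the average of [1] and the other [1 - F j]. Both are contractions, so extremality of
    [1] gives [x = 0]. *)
Lemma sum_cnorm_sub1_eq0 (I : finType) (P : pred I) (F : I -> A) :
  (forall i, P i -> star (F i) = F i) -> (forall i, P i -> cnorm (1 - F i) <= 1) ->
  \sum_(i | P i) F i = 0 -> forall i, P i -> F i = 0.
Proof.
move=> Fs Fn F0 i Pi.
pose m := #|P|.
have m0 : (0 < m)%N by apply/card_gt0P; exists i.
have N1 : cnorm (m%:R - F i) <= m%:R.
  have -> : m%:R - F i = 1 *+ m.-1 + (1 - F i).
    by rewrite addrA -mulrSr prednK.
  apply: le_trans (cnormD _ _) _; rewrite cnorm_mulrn.
  have -> : m%:R = m.-1%:R + 1 :> R by rewrite natr1 prednK.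
  apply: lerD; last exact: Fn.
  by rewrite -[leRHS]mulr1 ler_wpM2l // cnorm1_le1.
have N2 : cnorm (m%:R + F i) <= m%:R.
  have -> : m%:R + F i = 1 + \sum_(j | P j && (j != i)) (1 - F j).
    rewrite sumrB; move: F0; rewrite (bigD1 i) //= => /eqP; rewrite addr_eq0 => /eqP ->.
    rewrite addrA; congr (_ - _).
    have -> : m%:R = \sum_(j | P j) (1 : A) by rewrite sumr_const.
    by rewrite (bigD1 i).
  apply: le_trans (cnormD _ _) _.
  have -> : m%:R = 1 + \sum_(j | P j && (j != i)) 1 :> R.
    have -> : m%:R = \sum_(j | P j) (1 : R) by rewrite sumr_const.
    by rewrite (bigD1 i).
  apply: lerD; first exact: cnorm1_le1.
  apply: le_trans (cnorm_sum _ _ _) _; apply: ler_sum => j /andP[Pj _]; exact: Fn.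
pose r : R := m%:R^-1.
have r0 : 0 < r by rewrite invr_gt0 ltr0n.
have rm : r%:C *: (m%:R : A) = 1.
  by rewrite -scaler_nat scalerA -(rmorph_nat (@real_complex R)) -rmorphM /= mulVf ?scale1r // pnatr_eq0 -lt0n.
have bd (y : A) : cnorm y <= m%:R -> cnorm (r%:C *: y) <= 1.
  by move=> hy; rewrite cnormZr ?(ltW r0) // /r ler_pdivrMl ?ltr0n // mulr1.
have : r%:C *: F i = 0.
  apply: cnorm_extreme.
  - by rewrite starZ Fs //; congr (_ *: _); apply/conj_Creal; rewrite complex_real.
  - by rewrite -rm -scalerDr bd.
  - by rewrite -rm -scalerBr bd.
move/eqP; rewrite scaler_eq0 => /orP[|/eqP//].
by rewrite (fmorph_eq0 (@real_complex R)) gt_eqF.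
Qed.

End CStarFacts.

(** * Algebra of unital *-homomorphisms *)

Section StarMorphisms.
Variables (R : realType) (A B : cstarType R) (f : A -> B).
Hypothesis fP : star_morphism f.

Lemma star_morphismZ a x : f (a *: x) = a *: f x.
Proof.
have f0 : f 0 = 0.
  have := star_morphism_linear fP (-1) 0 0.
  by rewrite scaler0 add0r scaleN1r addNr.
by rewrite -[X in f X]addr0 (star_morphism_linear fP) f0 addr0.
Qed.

Lemma star_morphismD : {morph f : x y / x + y}.
Proof.
by move=> x y; rewrite -[x in LHS]scale1r (star_morphism_linear fP) scale1r.
Qed.

Lemma star_morphism_sum (I : Type) (r : seq I) (P : pred I) (F : I -> A) :
  f (\sum_(i <- r | P i) F i) = \sum_(i <- r | P i) f (F i).
Proof.
apply: (big_morph _ star_morphismD).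
by rewrite -[X in f X](scale0r 0) star_morphismZ scale0r.
Qed.

Lemma star_morphism1 : f 1 = 1.
Proof. by case: (star_morphism_mul fP). Qed.

Lemma star_morphismM : {morph f : x y / x * y}.
Proof. by case: (star_morphism_mul fP). Qed.

End StarMorphisms.

Lemma star_morphism_comp (R : realType) (A B C : cstarType R)
    (f : B -> C) (g : A -> B) :
  star_morphism f -> star_morphism g -> star_morphism (f \o g).
Proof.
move=> fP gP; split.
- by move=> a x y /=; rewrite !(star_morphism_linear gP, star_morphism_linear fP).
- by split=> [|x y] /=; rewrite ?star_morphism1 // !star_morphismM.
- by move=> x /=; rewrite (star_morphism_star gP) (star_morphism_star fP).
Qed.

Lemma star_morphism_id (R : realType) (A : cstarType R) :
  star_morphism (fun x : A => x).
Proof. by []. Qed.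

(** * Cuntz families and their endomorphisms *)

Section CuntzFacts.
Variables (R : realType) (G : finZmodType) (A : cstarType R) (S : G -> A).
Hypothesis SP : cuntz_relations S.

(* Multiplying [\sum_g S g * star (S g) = 1] by [star (S h)] and [S h] writes
   [0] as the sum of the [star x * x], [x = star (S g) * S h], [g != h]. *)
Lemma cuntz_orthogonal g h : star (S g) * S h = (g == h)%:R.
Proof.
have [iso sum1] := SP.
have [<-|ngh] := eqVneq g h; first exact: iso.
pose F k := star (star (S k) * S h) * (star (S k) * S h).
have Fsum : \sum_(k | k != h) F k = 0.
  have : star (S h) * (\sum_k S k * star (S k)) * S h = 1 by rewrite sum1 mulr1 iso.
  rewrite mulr_sumr mulr_suml (bigD1 h) //= !mulrA iso mul1r iso.
  move=> e; apply: (addrI (1 : A)); rewrite addr0 -[RHS]e.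
  by congr (_ + _); apply: eq_bigr => k _; rewrite /F starM starK !mulrA.
have : F g = 0.
  apply: (sum_cnorm_sub1_eq0 _ _ Fsum) => // [k _|k _].
    by rewrite /F [LHS]starM starK.
  (* The compression of a projection by the isometry [S h] is a product of three contractions. *)
  have -> : 1 - F k = star (S h) * (1 - S k * star (S k)) * S h.
    by rewrite mulrBr mulrBl mulr1 iso /F starM starK !mulrA.
  have hS := cnorm_isometry_le1 (iso h).
  have hS' : cnorm (star (S h)) <= 1.
    by apply: cnorm_star_le1; rewrite starK; apply: cnorm_projection_le1;
      rewrite ?starM ?starK // mulrA -[_ * _ * S h]mulrA iso mulr1.
  apply: cnormM_le1 hS; apply: cnormM_le1 hS' _.
  apply: cnorm_projection_le1.
    by rewrite starD star1 starN starM starK.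
  rewrite mulrBr mulr1 mulrBl mul1r mulrA -[_ * _ * S k]mulrA iso mulr1.
  by rewrite subrr subr0.
by move=> F0; apply: cnorm_eq0; apply/eqP; rewrite -sqrf_eq0 -cnorm_star -/(F g) F0 cnorm0.
Qed.

Lemma cuntz_orthogonal_mull x g h : x * star (S g) * S h = x *+ (g == h).
Proof. by rewrite -mulrA cuntz_orthogonal mulr_natr. Qed.

Lemma cuntz_relations_morph (B : cstarType R) (f : A -> B) :
  star_morphism f -> cuntz_relations (f \o S).
Proof.
move=> fP; have [iso sum1] := SP; split=> [g|] /=.
  by rewrite -(star_morphism_star fP) -(star_morphismM fP) iso star_morphism1.
rewrite -(star_morphism1 fP) -sum1 (star_morphism_sum fP).
by apply: eq_bigr => g _; rewrite (star_morphismM fP) (star_morphism_star fP).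
Qed.

(** For [u] the associated element, [star u * u] collapses because [rho] preserves orthogonality of
    the generators, and [u * star u] is the range sum of the Cuntz family [rho \o S]. *)
Lemma associated_unitary_lambda (rho : A -> A) :
  star_morphism rho -> is_lambda S (associated_unitary S rho) rho.
Proof.
move=> rhoP; have [iso sum1] := SP; have [_ rsum1] := cuntz_relations_morph rhoP.
have rhoE g : rho (S g) = associated_unitary S rho * S g.
  rewrite mulr_suml (bigD1 g) //= cuntz_orthogonal_mull eqxx big1 ?addr0 //.
  by move=> h hg; rewrite cuntz_orthogonal_mull (negPf hg).
split=> //; split.
  rewrite {1}/associated_unitary star_sum mulr_suml -[RHS]sum1.
  apply: eq_bigr => g _; rewrite starM starK -mulrA; congr (_ * _).
  rewrite mulr_sumr (bigD1 g) //= big1 => [|h hg]; rewrite mulrA.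
    by rewrite -(star_morphism_star rhoP) -(star_morphismM rhoP) iso star_morphism1 // mul1r addr0.
  rewrite -(star_morphism_star rhoP) -(star_morphismM rhoP) cuntz_orthogonal.
  rewrite eq_sym (negPf hg) -[X in rho X](scale0r 0) (star_morphismZ rhoP).
  by rewrite scale0r mul0r.
rewrite {2}/associated_unitary star_sum mulr_sumr -[RHS]rsum1.
by apply: eq_bigr => g _ /=; rewrite starM starK mulrA rhoE.
Qed.

Lemma sum_pair_tuple (F : 2.-tuple G -> A) :
  \sum_t F t = \sum_x \sum_y F [tuple x; y].
Proof.
rewrite pair_big /= (reindex (fun p : G * G => [tuple p.1; p.2])) //=.
exists (fun t : 2.-tuple G => (tnth t ord0, tnth t ord_max)) => [[x y]|t] _ //=.
by apply/val_inj; case: t => [[|x [|y []]]].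
Qed.

(** Words of length two suffice for both endomorphisms of the theorem; an injection of the finite
    set of pairs is already a permutation. *)
Lemma permutation_endomorphism_pair (rho : A -> A) (phi : G * G -> G * G) :
  injective phi -> star_morphism rho ->
  associated_unitary S rho = \sum_x \sum_y
    S (phi (x, y)).1 * S (phi (x, y)).2 * star (S x * S y) ->
  permutation_endomorphism S rho.
Proof.
move=> phiI rhoP rhoE.
pose pr (t : 2.-tuple G) := (tnth t ord0, tnth t ord_max).
pose s (t : 2.-tuple G) : 2.-tuple G := [tuple (phi (pr t)).1; (phi (pr t)).2].
have sI : injective s.
  move=> t t' /(congr1 pr); rewrite /pr /s /= -!surjective_pairing => /phiI [].
  case: t => [[|x [|y []]] // xy]; case: t' => [[|x' [|y' []]] // xy'] e1 e2.
  by apply/val_inj; move: e1 e2; rewrite /tnth /= => -> ->.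
exists 2, (perm sI); split=> //.
suff <- : associated_unitary S rho =
  \sum_alpha cuntz_word S (perm sI alpha) * star (cuntz_word S alpha).
  exact: associated_unitary_lambda.
rewrite rhoE sum_pair_tuple; apply: eq_bigr => x _; apply: eq_bigr => y _.
by rewrite permE /cuntz_word /= !big_cons !big_nil !mulr1.
Qed.

Lemma bogolyubov_of_linear (rho : A -> A) (m : G -> G -> R[i]) :
  bijective rho -> star_morphism rho ->
  (forall h, rho (S h) = \sum_g m g h *: S g) -> bogolyubov_automorphism S rho.
Proof.
move=> rhoB rhoP rhoE; split=> //; exists m.
suff <- : associated_unitary S rho = \sum_g \sum_h m g h *: (S g * star (S h)).
  exact: associated_unitary_lambda.
rewrite exchange_big; apply: eq_bigr => h _; rewrite rhoE mulr_suml.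
by apply: eq_bigr => g _; rewrite scalerAl.
Qed.

End CuntzFacts.

(** Both maps solve the universal problem for the Cuntz family [f \o S], whose solution is
    unique. *)
Lemma cuntz_endomorphism_ext (R : realType) (G : finZmodType) (On : cstarType R)
    (S : G -> On) (f f' : On -> On) :
  is_cuntz_algebra S -> star_morphism f -> star_morphism f' ->
  (forall g, f (S g) = f' (S g)) -> f = f'.
Proof.
move=> [SP univ] fP f'P ff'.
have [k [_ uniq_k]] := univ _ _ (cuntz_relations_morph SP fP).
rewrite -(uniq_k f) //; apply: uniq_k; split=> // g; exact/esym/ff'.
Qed.

(** * Fourier analysis on [G] inside a Cuntz family *)

Section Bracket.
Variables (R : realType) (G : finZmodType) (br : G -> G -> R[i]).
Hypothesis brP : symmetric_duality_bracket br.

Let c : R[i] := (sqrtC #|G|%:R)^-1.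

Lemma conj_inv_sqrtC_card : Num.conj c = c.
Proof. by apply/conj_Creal/ger0_real; rewrite invr_ge0 sqrtC_ge0 ler0n. Qed.

(** The squared modulus of [br 0 h] is [br 0 h * br (- 0) h], that is [br 0 h] itself. *)
Lemma bracket0 h : br 0 h = 1.
Proof.
have := normCK (br 0 h).
by rewrite (bracket_norm brP) expr1n (bracket_conj brP) (bracket_mul brP) oppr0 addr0.
Qed.

Lemma bracketNr g h : br g (- h) = br (- g) h.
Proof.
by rewrite -(bracket_conj brP) (bracket_sym brP g h) (bracket_conj brP) (bracket_sym brP).
Qed.

Lemma bracketN_swap g h : br (- g) h = br (- h) g.
Proof. by rewrite -bracketNr (bracket_sym brP). Qed.

(** Normalised orthogonality of characters, as [c * c] is the inverse of the order of [G]; every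
    Fourier inversion below goes through it. *)
Lemma bracket_fourier g : \sum_a c * c * br g a = (g == 0)%:R.
Proof.
rewrite -mulr_sumr; under eq_bigr do rewrite (bracket_sym brP).
rewrite (bracket_sum brP); case: eqP => _; last by rewrite mulr0.
have n0 : #|G|%:R != 0 :> R[i] by rewrite pnatr_eq0 -lt0n; apply/card_gt0P; exists 0.
by rewrite -invfM -expr2 sqrtCK mulVf.
Qed.

Variables (A : cstarType R) (S : G -> A).
Hypothesis SP : cuntz_relations S.

Let U (g : G) : A := \sum_h br g h *: (S h * star (S h)).
Let V (h : G) : A := c *: \sum_a br h a *: S a.

Lemma star_U g : star (U g) = U (- g).
Proof.
rewrite star_sum; apply: eq_bigr => h _.
by rewrite starZ (bracket_conj brP) starM starK.
Qed.

Lemma U0 : U 0 = 1.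
Proof.
by rewrite -(proj2 SP); apply: eq_bigr => h _; rewrite bracket0 scale1r.
Qed.

Lemma U_S g h : U g * S h = br g h *: S h.
Proof.
rewrite mulr_suml (bigD1 h) //= -scalerAl (cuntz_orthogonal_mull SP) eqxx.
rewrite big1 ?addr0 // => k kh.
by rewrite -scalerAl (cuntz_orthogonal_mull SP) (negPf kh) scaler0.
Qed.

Lemma U_mul g h : U g * U h = U (g + h).
Proof.
rewrite {2}/U mulr_sumr; apply: eq_bigr => k _.
by rewrite -scalerAr mulrA U_S -scalerAl scalerA (bracket_mul brP) addrC.
Qed.

Lemma star_U_mul g : star (U g) * U g = 1.
Proof. by rewrite star_U U_mul addNr U0. Qed.

Lemma U_star_mul g : U g * star (U g) = 1.
Proof. by rewrite star_U U_mul addrN U0. Qed.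

Lemma star_V h : star (V h) = c *: \sum_a br (- h) a *: star (S a).
Proof.
rewrite starZ conj_inv_sqrtC_card star_sum; congr (_ *: _).
by apply: eq_bigr => a _; rewrite starZ (bracket_conj brP).
Qed.

Lemma star_V_V g h : star (V g) * V h = (g == h)%:R.
Proof.
rewrite star_V -scalerAl -scalerAr scalerA mulr_suml scaler_sumr.
have -> : (g == h)%:R = ((h - g == 0)%:R : R[i]) *: (1 : A).
  by rewrite scaler_nat subr_eq0 eq_sym.
rewrite -bracket_fourier scaler_suml; apply: eq_bigr => a _.
rewrite -scalerAl mulr_sumr (bigD1 a) //= -scalerAr (cuntz_orthogonal SP) eqxx.
rewrite big1 ?addr0 => [|b ba]; last first.
  by rewrite -scalerAr (cuntz_orthogonal SP) eq_sym (negPf ba) scaler0.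
by rewrite !scalerA -mulrA (bracket_mul brP) addrC.
Qed.

(** Summing over [h] first leaves only [b = a + g] among the products [S a * star (S b)]. The case
    [g = 0] is the range sum of [V]; the general case computes [lambda (U g)]. *)
Lemma sum_V_star_V g :
  \sum_h br g h *: (V h * star (V h)) = \sum_a S a * star (S (a + g)).
Proof.
have E h : br g h *: (V h * star (V h)) =
    \sum_a \sum_b (c * c * br (g + a - b) h) *: (S a * star (S b)).
  rewrite star_V -scalerAl -scalerAr !scalerA mulr_suml scaler_sumr.
  apply: eq_bigr => a _; rewrite -(scalerAl _ (S a)) mulr_sumr !scaler_sumr.
  apply: eq_bigr => b _; rewrite -scalerAr !scalerA -!(bracket_mul brP).
  rewrite (bracketN_swap h b) (bracket_sym brP h a); congr (_ *: _); ring.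
under eq_bigr do rewrite E.
rewrite exchange_big; apply: eq_bigr => a _; rewrite exchange_big /=.
rewrite (bigD1 (a + g)) //= [X in _ + X]big1 => [|b bag].
  by rewrite -scaler_suml bracket_fourier [a + g]addrC subrr eqxx scale1r addr0.
by rewrite -scaler_suml bracket_fourier subr_eq0 eq_sym addrC (negPf bag) scale0r.
Qed.

Lemma cuntz_V : cuntz_relations V.
Proof.
split=> [g|]; first by rewrite star_V_V eqxx.
rewrite -(proj2 SP); transitivity (\sum_h br 0 h *: (V h * star (V h))).
  by apply: eq_bigr => h _; rewrite bracket0 scale1r.
by rewrite sum_V_star_V; apply: eq_bigr => a _; rewrite addr0.
Qed.

Lemma lambda_generatorE g :
  c *: \sum_h br g h *: (S h * star (U g)) = V g * star (U g).
Proof.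
rewrite -scalerAl mulr_suml; congr (_ *: _).
by apply: eq_bigr => h _; rewrite scalerAl.
Qed.

Lemma cuntz_lambda : cuntz_relations (fun g => V g * star (U g)).
Proof.
split=> [g|].
  rewrite starM starK mulrA -[_ * star (V g) * _]mulrA star_V_V eqxx mulr1.
  exact: U_star_mul.
rewrite -(proj2 cuntz_V); apply: eq_bigr => g _.
by rewrite starM starK mulrA -[_ * star (U g) * _]mulrA star_U_mul mulr1.
Qed.

(** The left side is the future [lambda (V h)]. Expanding [star (U a)] as [U (- a)], the sum over
    [a] leaves only [k = h + b]. *)
Lemma sum_bracket_lambda h :
  c *: \sum_a br h a *: (V a * star (U a)) = \sum_b S b * S (h + b) * star (S (h + b)).
Proof.
have E a : c *: (br h a *: (V a * star (U a))) =
    \sum_b \sum_k (c * c * br (h + b - k) a) *: (S b * (S k * star (S k))).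
  rewrite star_U /V -scalerAl !scalerA mulr_suml scaler_sumr.
  apply: eq_bigr => b _; rewrite -(scalerAl _ (S b)) mulr_sumr !scaler_sumr.
  apply: eq_bigr => k _; rewrite -scalerAr !scalerA -!(bracket_mul brP).
  rewrite (bracketN_swap a k) (bracket_sym brP a b); congr (_ *: _); ring.
rewrite scaler_sumr; under eq_bigr do rewrite E.
rewrite exchange_big; apply: eq_bigr => b _; rewrite exchange_big /=.
rewrite (bigD1 (h + b)) //= [X in _ + X]big1 => [|k khb].
  by rewrite -scaler_suml bracket_fourier subrr eqxx scale1r addr0 mulrA.
by rewrite -scaler_suml bracket_fourier subr_eq0 eq_sym (negPf khb) scale0r.
Qed.

(** The Fourier transform squares to the reflection of [G]. *)
Lemma sum_bracket_V h : c *: \sum_a br h a *: V a = S (- h).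
Proof.
have E a : c *: (br h a *: V a) = \sum_b (c * c * br (h + b) a) *: S b.
  rewrite /V !scalerA scaler_sumr; apply: eq_bigr => b _.
  rewrite scalerA -(bracket_mul brP) (bracket_sym brP a b); congr (_ *: _); ring.
rewrite scaler_sumr; under eq_bigr do rewrite E.
rewrite exchange_big /= (bigD1 (- h)) //= [X in _ + X]big1 => [|b bh].
  by rewrite -scaler_suml bracket_fourier subrr eqxx scale1r addr0.
by rewrite -scaler_suml bracket_fourier addrC addr_eq0 (negPf bh) scale0r.
Qed.

Lemma bogolyubov_V_sqr (beta : A -> A) h : star_morphism beta ->
  (forall g, beta (S g) = V g) -> beta (beta (S h)) = S (- h).
Proof.
move=> betaP betaE; rewrite betaE -sum_bracket_V (star_morphismZ betaP).
rewrite (star_morphism_sum betaP); congr (_ *: _); apply: eq_bigr => a _.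
by rewrite (star_morphismZ betaP) betaE.
Qed.

(** * Values of [lambda] on [V], on [U] and on its own image *)

Section Lambda.
Variable lambda : A -> A.
Hypothesis lambdaP : star_morphism lambda.
Hypothesis lambdaE : forall g, lambda (S g) = V g * star (U g).

Lemma lambda_V h : lambda (V h) = \sum_b S b * S (h + b) * star (S (h + b)).
Proof.
rewrite -sum_bracket_lambda (star_morphismZ lambdaP) (star_morphism_sum lambdaP).
congr (_ *: _); apply: eq_bigr => a _.
by rewrite (star_morphismZ lambdaP) lambdaE.
Qed.

(** The unitaries [U h] cancel in [lambda (S h * star (S h))], leaving [V h * star (V h)]. *)
Lemma lambda_U g : lambda (U g) = \sum_a S a * star (S (a + g)).
Proof.
rewrite -sum_V_star_V (star_morphism_sum lambdaP); apply: eq_bigr => h _.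
rewrite (star_morphismZ lambdaP) (star_morphismM lambdaP).
rewrite (star_morphism_star lambdaP) lambdaE starM starK mulrA.
by rewrite -[_ * star (U h) * _]mulrA star_U_mul mulr1.
Qed.

Lemma lambda_lambda g : lambda (lambda (S g)) = \sum_k S k * S (g + k) * star (S k).
Proof.
rewrite lambdaE (star_morphismM lambdaP) (star_morphism_star lambdaP).
rewrite lambda_V lambda_U star_sum mulr_suml; apply: eq_bigr => b _.
rewrite mulr_sumr (bigD1 b) //= [X in _ + X]big1 => [|a ab]; rewrite starM starK mulrA.
  by rewrite (cuntz_orthogonal_mull SP) [b + g]addrC eqxx addr0.
rewrite (cuntz_orthogonal_mull SP) [a + g]addrC (inj_eq (addrI g)) eq_sym.
by rewrite (negPf ab) mul0r.
Qed.

End Lambda.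

End Bracket.

Theorem mainTheorem7 (R : realType) (G : finZmodType)
    (br : G -> G -> R[i]) (On : cstarType R) (S : G -> On)
    (card_G : (2 <= #|G|)%N)
    (br_duality : symmetric_duality_bracket br)
    (O_cuntz : is_cuntz_algebra S) :
  let U (g : G) : On := \sum_h br g h *: (S h * star (S h)) in
  let c : R[i] := (sqrtC #|G|%:R)^-1 in
  let lambda_spec (lambda : On -> On) := star_morphism lambda /\
    forall g, lambda (S g) = c *: \sum_h br g h *: (S h * star (U g)) in
  let beta_spec (beta : On -> On) := star_morphism beta /\
    forall h, beta (S h) = c *: \sum_a br h a *: S a in
  (exists! lambda : On -> On, lambda_spec lambda) /\
  (exists! beta : On -> On, beta_spec beta) /\
  forall lambda beta : On -> On, lambda_spec lambda -> beta_spec beta ->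
    bogolyubov_automorphism S beta /\
    [/\ permutation_endomorphism S (lambda \o beta),
        forall h, (lambda \o beta) (S h) =
          \sum_b S b * S (h + b) * star (S (h + b))
      & exists rho gamma : On -> On,
          [/\ permutation_endomorphism S rho, bogolyubov_automorphism S gamma
            & lambda = rho \o gamma]] /\
    [/\ permutation_endomorphism S (lambda \o lambda),
        forall g, (lambda \o lambda) (S g) =
          \sum_k S k * S (g + k) * star (S k),
        associated_unitary S (lambda \o lambda) =
          \sum_g \sum_h S g * S (h + g) * star (S g) * star (S h)
      & is_lambda S (associated_unitary S (lambda \o lambda))
          (lambda \o lambda)].
Proof.
move=> U c lambda_spec beta_spec; have [SP univ] := O_cuntz.
have cuntz_T : cuntz_relations (fun g => c *: \sum_h br g h *: (S h * star (U g))).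
  have [T1 T2] := cuntz_lambda br_duality SP.
  split=> [g|]; first by rewrite lambda_generatorE.
  by rewrite -[RHS]T2; apply: eq_bigr => g _; rewrite lambda_generatorE.
split; first exact: univ _ _ cuntz_T.
split; first exact: univ _ _ (cuntz_V br_duality SP).
move=> lambda beta [lambdaP lambda_S] [betaP betaE].
have lambdaE g : lambda (S g) = (c *: \sum_a br g a *: S a) * star (U g).
  by rewrite lambda_S lambda_generatorE.
have beta2 := bogolyubov_V_sqr br_duality _ betaP betaE.
pose gamma := beta \o (beta \o beta).
have gammaP : star_morphism gamma by do 2!apply: star_morphism_comp => //.
have gamma_beta : beta \o gamma = id.
  apply: (cuntz_endomorphism_ext O_cuntz) => [||g]; first exact: star_morphism_comp.
  - exact: star_morphism_id.
  - by rewrite -[LHS]/(beta (beta (beta (beta (S g))))) !beta2 opprK.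
have betaK x : beta (gamma x) = x by rewrite -[LHS]/((beta \o gamma) x) gamma_beta.
(* Both [beta (gamma x)] and [gamma (beta x)] unfold to the fourth iterate of [beta], so [betaK]
   proves both inverse laws. *)
have beta_bij : bijective beta by exists gamma => x; exact: betaK.
have gamma_bij : bijective gamma by exists beta => x; exact: betaK.
have lbP : star_morphism (lambda \o beta) by exact: star_morphism_comp.
have llP : star_morphism (lambda \o lambda) by exact: star_morphism_comp.
have lbE h : (lambda \o beta) (S h) = \sum_b S b * S (h + b) * star (S (h + b)).
  by rewrite /= betaE (lambda_V br_duality lambdaP lambdaE).
have llE := lambda_lambda br_duality SP lambdaP lambdaE.
have lb_perm : permutation_endomorphism S (lambda \o beta).
  apply: (permutation_endomorphism_pair SP (phi := fun p => (p.2 - p.1, p.2))) => //.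
    by move=> [x y] [x' y'] /= [] /[swap] -> /addrI /oppr_inj ->.
  (* Replacing [b] by [- h + b] turns the source word into [S h * S b] and the target word into
     [S (b - h) * S b]. *)
  apply: eq_bigr => h _; rewrite lbE mulr_suml (reindex_inj (addrI (- h))) /=.
  by apply: eq_bigr => b _; rewrite starM mulrA addNKr [- h + _]addrC.
have assocE : associated_unitary S (lambda \o lambda) =
    \sum_g \sum_h S g * S (h + g) * star (S g) * star (S h).
  by rewrite exchange_big; apply: eq_bigr => h _; rewrite /= llE mulr_suml.
split.
  apply: (bogolyubov_of_linear SP (m := fun g h => c * br h g)) => // h.
  by rewrite betaE scaler_sumr; apply: eq_bigr => a _; rewrite scalerA.
split; split=> //.
- exists (lambda \o beta), gamma; split=> //.
    (* Here [gamma (S h) = beta (S (- h))], so the matrix of [gamma] is the entrywise conjugate of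
       that of [beta]. *)
    apply: (bogolyubov_of_linear SP (m := fun g h => c * br (- h) g)) => // h.
    rewrite -[LHS]/(beta (beta (beta (S h)))) beta2 betaE scaler_sumr; apply: eq_bigr => a _.
    by rewrite scalerA.
  by rewrite -[RHS]/(lambda \o (beta \o gamma)) gamma_beta.
- apply: (permutation_endomorphism_pair SP (phi := fun p => (p.2, p.1 + p.2))) => //.
    by move=> [x y] [x' y'] /= [] -> /addIr ->.
  rewrite assocE exchange_big; apply: eq_bigr => h _; apply: eq_bigr => k _.
  by rewrite starM mulrA.
- exact: associated_unitary_lambda.
Qed.
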